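(* Let $t>1$ be a real number. There exist constants $c,C>0$, depending only on $t$, such that the following holds. Let $N\ge 1$ be an integer and $0<p<1$, let $X$ be the number of Schur triples in the random set $[N]_p$, and let $\mu=\mathbb E X$. If $\mu\ge 1$ and $t\le p^{-3}$, then $$p^{CNp^{3/2}}=\exp\{-CNp^{3/2}\log(1/p)\}\le \mathbb P(X\ge t\mu)\le\exp\{-cNp^{3/2}\}.$$
   Context: $[N]=\{1,2,\dots,N\}$, and $[N]_p$ is the random subset of $[N]$ that includes each element independently with probability $p$. A Schur triple is a set $\{x,y,z\}$ of positive integers such that $x+y=z$ and $x\ne y$; $X$ counts the Schur triples contained in $[N]_p$, so $\mu$ equals $p^3$ times the number of Schur triples contained in $[N]$. *)

(* Defs.v *)
From mathcomp Require Import all_boot all_order all_algebra.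
From mathcomp Require Import reals.
From mathcomp Require Import zify.

Set Implicit Arguments.
Unset Strict Implicit.
Unset Printing Implicit Defensive.

Import Order.TTheory GRing.Theory Num.Theory.
Local Open Scope ring_scope.

(* Subsets of [N] = {1, ..., N} are encoded as A : {set 'I_N}, the ordinal    *)
(* i : 'I_N standing for the positive integer i.+1.                           *)

Definition schur_triple (N : nat) (B : {set 'I_N}) : bool :=
  [exists x : 'I_N, exists y : 'I_N, exists z : 'I_N,
    [&& (x.+1 + y.+1 == z.+1)%N, x != y & B == [set x; y; z]]].

Definition schur_count (N : nat) (A : {set 'I_N}) : nat :=
  #|[set B : {set 'I_N} | schur_triple B & B \subset A]|.

(* The probability that [N]_p equals A: a product over the elements of [N],   *)
(* since each one is included independently with probability p.               *)
Definition rset_mass (R : realType) (N : nat) (p : R) (A : {set 'I_N}) : R :=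
  \prod_(i < N) (if i \in A then p else 1 - p).

Definition rset_prob (R : realType) (N : nat) (p : R)
    (E : pred {set 'I_N}) : R :=
  \sum_(A : {set 'I_N} | E A) rset_mass p A.

Definition rset_mean (R : realType) (N : nat) (p : R)
    (Y : {set 'I_N} -> R) : R :=
  \sum_(A : {set 'I_N}) rset_mass p A * Y A.

Definition schur_mean (R : realType) (N : nat) (p : R) : R :=
  rset_mean p (fun A : {set 'I_N} => (schur_count A)%:R).

(* The inclusion events are mutually independent, each of probability p.      *)
Lemma rset_prob_subset (R : realType) (N : nat) (p : R) (B : {set 'I_N}) :
  rset_prob p (fun A : {set 'I_N} => B \subset A) = p ^+ #|B|.
Proof.
transitivity (\prod_(i < N) (p + (if i \in B then 0 else 1 - p))).
  rewrite bigA_distr [RHS](bigID (fun A : {set 'I_N} => B \subset A)) /=.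
  rewrite [X in _ + X]big1 ?addr0 => [|A /subsetPn[i iB iA]]; last first.
    by rewrite (bigD1 i) //= (negbTE iA) iB mul0r.
  apply: eq_bigr => A /subsetP sBA; apply: eq_bigr => i _.
  by case: ifP => // iA; case: ifP => // /sBA; rewrite iA.
rewrite -prodr_const [RHS]big_mkcond /=; apply: eq_bigr => i _.
by case: ifP => _; rewrite ?addr0 // addrC subrK.
Qed.

Lemma rset_prob_true (R : realType) (N : nat) (p : R) :
  rset_prob (N := N) p xpredT = 1.
Proof.
rewrite -(expr0 p) -(cards0 'I_N) -rset_prob_subset.
by apply: eq_bigl => A; rewrite sub0set.
Qed.

Lemma schur_meanE (R : realType) (N : nat) (p : R) :
  schur_mean N p = p ^+ 3 * (schur_count [set: 'I_N])%:R.
Proof.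
rewrite /schur_mean /rset_mean /schur_count.
transitivity (\sum_(B : {set 'I_N} | schur_triple B) p ^+ #|B|).
  under [RHS]eq_bigr => B _ do rewrite -rset_prob_subset /rset_prob big_mkcond.
  rewrite exchange_big /=; apply: eq_bigr => A _.
  rewrite mulr_natr -big_mkcondr sumr_const; congr (_ *+ _).
  by apply: eq_card => B; rewrite inE.
rewrite mulr_natr -sumr_const; apply: eq_big => [B|B].
  by rewrite inE subsetT andbT.
case/existsP=> x /existsP[y] /existsP[z] /and3P[/eqP xyz nxy /eqP ->].
congr (_ ^+ _); rewrite finset.setUC cardsU1 cards2 nxy !inE.
have /negbTE-> : z != x by apply: contraTneq nxy => zx; move: xyz; rewrite zx; lia.
have /negbTE-> // : z != y.
by apply: contraTneq nxy => zy; move: xyz; rewrite zy; lia.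
Qed.

(* Main.v *)
Require Import Defs.
From mathcomp Require Import all_boot all_order all_algebra.
From mathcomp Require Import reals sequences exp.
From mathcomp Require Import zify ring lra.

Set Implicit Arguments.
Unset Strict Implicit.
Unset Printing Implicit Defensive.

Import Order.TTheory GRing.Theory Num.Theory.
Local Open Scope ring_scope.

(** Write q = N p^(3/2), so that q^2 = N^2 p^3 has the order of mu: the number
    T of Schur triples in [N] satisfies N^2 / 25 <= T <= 2 N^2 as soon as
    T > 0.

    Lower bound ([schur_tail_ge]).  An initial segment [m] already contains
    (m/3)^2 triples, so that some m = O(q) makes the triples inside [m] alone
    number at least t mu; all of [m] is selected with probability p^m.  When
    this m exceeds N, the whole of [N] is planted instead, and t <= p^-3 says
    precisely that T >= t mu.

    Upper bound ([schur_tail_le]).  Markov's inequality is applied to X^k with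
    k just above a q, for a small constant a.  Expanding, E X^k is a sum over
    k-tuples of triples of p^(size of their union).  The triples are chosen one
    after the other: if those chosen before cover a set V, the next one, B,
    contributes a factor p^|B \ V|.  Hence E X^k <= M^k where M bounds
    sum_B p^|B \ V| over all V with |V| <= 3 (k - 1)
    ([edge_count_moment]).  In the sum, the triples disjoint from V contribute
    at most mu.  As two distinct integers lie in at most two common triples, at
    most 2 N |V| triples meet V, which costs at most 2 N |V| p^2, and at most
    2 |V|^2 triples have two elements in V ([sum_residual_le]).  With
    |V| <= 3 a q both are O(a q^2) = O(a mu), so M <= (1 + 600 a) mu, and
    P(X >= t mu) <= ((1 + 600 a) / t)^k, which is exponentially small in q once
    1 + 600 a < t.  Rounding a q up to k >= 1 also covers a q < 1, where the
    bound is Markov's inequality for X itself. *)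

(** * Moments of edge counts in a random set *)

Definition edge_count (N : nat) (H : {set {set 'I_N}}) (A : {set 'I_N}) : nat :=
  #|[set B in H | B \subset A]|.

Lemma edge_count_monotone (N : nat) (H : {set {set 'I_N}}) (A B : {set 'I_N}) :
  A \subset B -> (edge_count H A <= edge_count H B)%N.
Proof.
move=> AB; apply/subset_leq_card/subsetP => E; rewrite !inE => /andP[-> EA].
exact: subset_trans EA AB.
Qed.

Lemma rset_mass_ge0 (R : realType) (N : nat) (p : R) (A : {set 'I_N}) :
  0 <= p <= 1 -> 0 <= rset_mass p A.
Proof.
by move=> /andP[p0 p1]; apply: prodr_ge0 => i _; case: ifP; rewrite // subr_ge0.
Qed.

Lemma rset_prob_le (R : realType) (N : nat) (p : R) (E F : pred {set 'I_N}) :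
  0 <= p <= 1 -> subpred E F -> rset_prob p E <= rset_prob p F.
Proof.
move=> p01 EF; rewrite /rset_prob big_mkcond [leRHS]big_mkcond /=.
apply: ler_sum => A _; case: ifP => [/EF -> //|_].
by case: ifP => // _; exact: rset_mass_ge0.
Qed.

Lemma rset_markov (R : realType) (N : nat) (p a : R) (k : nat)
    (Y : {set 'I_N} -> R) :
  0 <= p <= 1 -> 0 < a -> (forall A, 0 <= Y A) ->
  rset_prob p (fun A => a <= Y A) <= rset_mean p (fun A => Y A ^+ k) / a ^+ k.
Proof.
move=> p01 a0 Y0; rewrite ler_pdivlMr ?exprn_gt0// mulr_suml big_mkcond /=.
apply: ler_sum => A _; have m0 := rset_mass_ge0 A p01.
case: ifP => aY; last by rewrite mulr_ge0// exprn_ge0.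
by rewrite ler_wpM2l// lerXn2r// nnegrE ?Y0// ltW.
Qed.

(** A weighted form of E X^k <= M^k, restricted to the event that U is selected
    so that the induction on k closes: X^(k+1) 1[U <= A] is the sum over B of
    X^k 1[U + B <= A], and U + B has |U| + |B \ U| elements.  Only sets V
    arising as U together with at most k - 1 edges occur, whence the size
    condition. *)
Lemma edge_count_moment (R : realType) (N r : nat) (H : {set {set 'I_N}})
    (p M : R) (k : nat) (U : {set 'I_N}) :
  0 <= p <= 1 -> (forall B, B \in H -> #|B| <= r)%N ->
  (forall V : {set 'I_N}, (#|V| + r <= #|U| + r * k)%N ->
     \sum_(B in H) p ^+ #|B :\: V| <= M) ->
  \sum_(A : {set 'I_N} | U \subset A) rset_mass p A * (edge_count H A)%:R ^+ k
    <= p ^+ #|U| * M ^+ k.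
Proof.
move=> p01 Hr; have /andP[p0 p1] := p01.
elim: k U => [|k IH] U HM.
  under eq_bigr do rewrite mulr1.
  by rewrite mulr1 -rset_prob_subset.
have HU : \sum_(B in H) p ^+ #|B :\: U| <= M by apply: HM; rewrite mulnS; lia.
have M0 : 0 <= M by apply: le_trans HU; apply: sumr_ge0 => B _; rewrite exprn_ge0.
have -> : \sum_(A : {set 'I_N} | U \subset A)
             rset_mass p A * (edge_count H A)%:R ^+ k.+1
        = \sum_(B in H) \sum_(A : {set 'I_N} | U :|: B \subset A)
             rset_mass p A * (edge_count H A)%:R ^+ k.
  under [RHS]eq_bigr do rewrite big_mkcond.
  rewrite [RHS]exchange_big /= big_mkcond; apply: eq_bigr => A _.
  under [RHS]eq_bigr do rewrite subUset.
  case: ifP => UA /=; last by rewrite big1.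
  rewrite -big_mkcondr sumr_const exprSr mulrA mulr_natr; congr (_ *+ _).
  by apply: eq_card => B; rewrite !inE.
apply: (@le_trans _ _ (\sum_(B in H) p ^+ #|U :|: B| * M ^+ k)).
  apply: ler_sum => B BH; apply: IH => V HV; apply: HM.
  have := Hr B BH; have [+ _] := leq_card_setU U B; move: HV.
  by rewrite mulnS; lia.
rewrite -mulr_suml exprS mulrA ler_wpM2r ?exprn_ge0//.
under eq_bigr => B _.
  have -> : #|U :|: B| = (#|U| + #|B :\: U|)%N.
    by rewrite cardsU cardsD (setIC B) addnBA// subset_leq_card// subsetIr.
  rewrite exprD; over.
by rewrite -mulr_sumr ler_wpM2l// exprn_ge0.
Qed.

(** * Hypergraphs of bounded codegree *)

Definition codegree_le (N d : nat) (H : {set {set 'I_N}}) : Prop :=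
  forall v w : 'I_N, v != w -> (#|[set B in H | (v \in B) && (w \in B)]| <= d)%N.

(** Each edge of H' contains a pair of V x W off the diagonal, and each such
    pair is in at most d edges. *)
Lemma card_edges_meeting (N d : nat) (H H' : {set {set 'I_N}})
    (V W : {set 'I_N}) :
  codegree_le d H -> H' \subset H ->
  (forall B, B \in H' -> exists v w, [/\ v \in V :&: B, w \in W :&: B & v != w]) ->
  (#|H'| <= d * (#|V| * #|W|))%N.
Proof.
move=> Hd /subsetP HH ex.
apply: (@leq_trans (\sum_(e in setX V W)
    #|[set B in H | [&& e.1 != e.2, e.1 \in B & e.2 \in B]]|)).
  apply: (@leq_trans #|\bigcup_(e in setX V W)
      [set B in H | [&& e.1 != e.2, e.1 \in B & e.2 \in B]]|); last first.
    elim/big_ind2: _ => [|m A n B Am Bn|//]; first by rewrite cards0.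
    exact: leq_trans (leq_card_setU A B).1 (leq_add Am Bn).
  apply/subset_leq_card/subsetP => B BH'.
  have [v [w [/setIP[vV vB] /setIP[wW wB] vw]]] := ex B BH'.
  apply/bigcupP; exists (v, w); first by rewrite in_setX vV.
  by rewrite inE HH//= vw vB wB.
rewrite mulnC -cardsX -sum_nat_const; apply: leq_sum => -[v w] _ /=.
have [->|vw] := eqVneq v w; last exact: Hd.
rewrite (_ : [set _ in _ | _] = set0) ?cards0//.
by apply/setP => B; rewrite !inE andbF.
Qed.

(** For |B| = 3 the exponent |B \ V| is 3, 2 or at most 1 according as B has
    no, one or several elements in V.  An edge meeting V contains a pair in
    V x [N], and an edge with two elements in V contains a pair in V x V. *)
Lemma sum_residual_le (R : realType) (N d : nat) (H : {set {set 'I_N}})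
    (p : R) (V : {set 'I_N}) :
  0 <= p <= 1 -> codegree_le d H -> (forall B, B \in H -> #|B| = 3) ->
  \sum_(B in H) p ^+ #|B :\: V|
    <= p ^+ 3 * #|H|%:R + (d * (#|V| * N))%:R * p ^+ 2 + (d * (#|V| * #|V|))%:R.
Proof.
move=> /andP[p0 p1] Hd H3.
pose H1 := [set B in H | (0 < #|V :&: B|)%N].
pose H2 := [set B in H | (1 < #|V :&: B|)%N].
have H1le : (#|H1| <= d * (#|V| * N))%N.
  suff : (#|H1| <= d * (#|V| * #|[set: 'I_N]|))%N by rewrite cardsT card_ord.
  apply: (card_edges_meeting Hd); first by apply/subsetP => B; rewrite inE => /andP[].
  move=> B; rewrite inE => /andP[BH /card_gt0P[v vVB]].
  have : (0 < #|B :\ v|)%N.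
    by have := cardsD1 v B; case/setIP: vVB => _ ->; rewrite (H3 B BH); lia.
  move=> /card_gt0P[w]; rewrite !inE => /andP[wv wB].
  by exists v, w; rewrite setTI wB eq_sym wv.
have H2le : (#|H2| <= d * (#|V| * #|V|))%N.
  apply: (card_edges_meeting Hd); first by apply/subsetP => B; rewrite inE => /andP[].
  move=> B; rewrite inE => /andP[BH /card_gt1P[v [w [? ? ?]]]].
  by exists v, w.
apply: (@le_trans _ _ (\sum_(B in H) (p ^+ 3 + ((0 < #|V :&: B|)%N)%:R * p ^+ 2
    + ((1 < #|V :&: B|)%N)%:R))).
  apply: ler_sum => B BH; rewrite cardsD H3// setIC.
  have p2 : 0 <= p ^+ 2 by rewrite exprn_ge0.
  have p3 : 0 <= p ^+ 3 by rewrite exprn_ge0.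
  case: #|V :&: B| => [|[|n]] /=; rewrite ?mul0r ?mul1r ?addr0 ?lerDr//.
  by rewrite (le_trans (exprn_ile1 (3 - n.+2) p0 p1))// lerDr addr_ge0.
rewrite !big_split /= sumr_const mulr_natr -mulr_suml -!natr_sum -!lerBlDl.
have -> : (\sum_(B in H) (0 < #|V :&: B|))%N = #|H1|.
  by rewrite -sum1_card big_mkcond [RHS]big_mkcond; apply: eq_bigr => B _;
     rewrite inE; case: (B \in H); case: ltnP.
have -> : (\sum_(B in H) (1 < #|V :&: B|))%N = #|H2|.
  by rewrite -sum1_card big_mkcond [RHS]big_mkcond; apply: eq_bigr => B _;
     rewrite inE; case: (B \in H); case: ltnP.
have h1 : #|H1|%:R * p ^+ 2 <= (d * (#|V| * N))%:R * p ^+ 2 :> R.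
  by rewrite ler_wpM2r ?exprn_ge0// ler_nat.
have h2 : #|H2|%:R <= (d * (#|V| * #|V|))%:R :> R by rewrite ler_nat.
lra.
Qed.

(** * Counting Schur triples *)

Definition schur_triples (N : nat) : {set {set 'I_N}} :=
  [set B | schur_triple B].

Lemma schur_countE (N : nat) (A : {set 'I_N}) :
  schur_count A = edge_count (schur_triples N) A.
Proof. by apply: eq_card => B; rewrite !inE. Qed.

Lemma schur_countT (N : nat) : schur_count [set: 'I_N] = #|schur_triples N|.
Proof. by apply: eq_card => B; rewrite !inE subsetT andbT. Qed.

Lemma schur_tripleP (N : nat) (B : {set 'I_N}) :
  reflect (exists x y z : 'I_N,
    [/\ (x.+1 + y.+1 = z.+1)%N, x != y & B = [set x; y; z]]) (schur_triple B).
Proof.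
apply: (iffP existsP) => [[x /existsP[y /existsP[z]]]|[x [y [z [e xy ->]]]]].
  by move=> /and3P[/eqP ? ? /eqP ?]; exists x, y, z.
exists x; apply/existsP; exists y; apply/existsP; exists z.
by rewrite e xy !eqxx.
Qed.

Lemma card_schur_triple (N : nat) (B : {set 'I_N}) :
  B \in schur_triples N -> #|B| = 3.
Proof.
rewrite inE => /schur_tripleP[x [y [z [e xy ->]]]].
rewrite finset.setUC cardsU1 cards2 xy !inE -!(inj_eq val_inj) /=.
by case: eqP => [|_]; [lia|case: eqP => [|_]; [lia|]].
Qed.

(** The third element of a triple containing v and w is their sum or their
    difference; the shifts come from the ordinal i standing for i + 1. *)
Lemma codegree_schur (N : nat) : codegree_le 2 (schur_triples N).
Proof.
move=> v w vw.
pose third (k : nat) := [set v; w; insubd v k].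
have : [set B in schur_triples N | (v \in B) && (w \in B)]
    \subset [set third (v + w).+1; third (maxn v w - minn v w).-1].
  apply/subsetP => B; rewrite !inE => /andP[/schur_tripleP[x [y [z [e xy ->]]]]].
  have third_eq (a : 'I_N) (k : nat) (u : 'I_N) : k = u -> insubd a k = u.
    by move=> ->; exact: valKd.
  have xyN : (x : nat) <> y by move=> /val_inj /eqP; rewrite (negPf xy).
  have set3 (a b c : 'I_N) : [set a; b; c] = [set b; a; c].
    by rewrite (finset.setUC [set a]).
  have set3' (a b c : 'I_N) : [set a; b; c] = [set a; c; b].
    by rewrite -!finset.setUA (finset.setUC [set b]).
  rewrite !inE /third.
  move=> /andP[/orP[/orP[]|] /eqP vE /orP[/orP[]|] /eqP wE];
    move: vw; rewrite vE wE ?eqxx// => _; apply/orP.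
  - by left; rewrite (third_eq _ _ z)//; lia.
  - by right; rewrite (third_eq _ _ y) ?(set3' x z)//; lia.
  - by left; rewrite (third_eq _ _ z) ?(set3 y x)//; lia.
  - by right; rewrite (third_eq _ _ x) ?(set3' y z) ?(set3 y x)//; lia.
  - by right; rewrite (third_eq _ _ y) ?(set3 z x) ?(set3' x z)//; lia.
  - by right; rewrite (third_eq _ _ x) ?(set3 z y) ?(set3' y z) ?(set3 y x)//; lia.
move=> /subset_leq_card /leq_trans; apply.
by rewrite cards2; case: eqP.
Qed.

Lemma schur_count_le (N : nat) : (schur_count [set: 'I_N] <= 2 * N ^ 2)%N.
Proof.
rewrite schur_countT -mulnn.
suff : (#|schur_triples N| <= 2 * (#|[set: 'I_N]| * #|[set: 'I_N]|))%N.
  by rewrite cardsT card_ord.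
apply: (card_edges_meeting (@codegree_schur N)) => // B.
rewrite inE => /schur_tripleP[x [y [z [_ xy ->]]]].
by exists x, y; rewrite !setTI !inE !eqxx ?orbT.
Qed.

(** With h = m / 3, every x in {1..h} and y in {h+1..2h} give a triple
    {x, y, x + y} inside [m], and x < y < x + y makes these h^2 triples
    distinct. *)
Lemma schur_count_initial (N m : nat) : (m <= N)%N ->
  ((m %/ 3) ^ 2 <= schur_count [set i : 'I_N | (i < m)%N])%N.
Proof.
case: N => [|N] mN; first by move: mN; rewrite leqn0 => /eqP ->.
set h := (m %/ 3)%N.
pose f (e : 'I_h * 'I_h) : {set 'I_N.+1} :=
  [set inord e.1; inord (h + e.2); inord (e.1 + (h + e.2)).+1].
have hm : (3 * h <= m)%N by rewrite mulnC leq_divM.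
have f_inj : injective f.
  move=> [a b] [a' b'] /setP ff.
  have [la lb] := (ltn_ord a, ltn_ord b).
  have [la' lb'] := (ltn_ord a', ltn_ord b').
  have meq (k l : nat) : (k < N.+1)%N -> (l < N.+1)%N ->
      ((inord k : 'I_N.+1) == inord l) = (k == l).
    by move=> kN lN; rewrite -val_eqE /= !inordK.
  have ea : (a : nat) = a'.
    have := ff (inord a); rewrite !inE /= !meq; lia.
  have eb : (h + b = h + b' \/ h + b = (a' + (h + b')).+1)%N.
    have := ff (inord (h + b)); rewrite !inE /= !meq; lia.
  have eb' : (h + b' = h + b \/ h + b' = (a + (h + b)).+1)%N.
    have := ff (inord (h + b')); rewrite !inE /= !meq; lia.
  have eb'' : (b : nat) = b' by lia.
  by move: ea eb'' => /val_inj -> /val_inj ->.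
have -> : (h ^ 2 = #|f @: setT|)%N.
  by rewrite card_imset// cardsT card_prod card_ord mulnn.
apply/subset_leq_card/subsetP => _ /imsetP[[a b] _ ->].
have [la lb] := (ltn_ord a, ltn_ord b).
rewrite inE; apply/andP; split.
  apply/schur_tripleP; exists (inord a), (inord (h + b)), (inord (a + (h + b)).+1).
  split=> //; first by rewrite !inordK /=; lia.
  by rewrite -val_eqE /= !inordK; lia.
apply/subsetP => i; rewrite !inE => /orP[/orP[]|] /eqP -> /=; rewrite inordK; lia.
Qed.

Lemma schur_count_ge (N : nat) : (0 < schur_count [set: 'I_N])%N ->
  (N ^ 2 <= 25 * schur_count [set: 'I_N])%N.
Proof.
move=> T0.
have N3 : (3 <= N)%N.
  move: T0; rewrite schur_countT => /card_gt0P[B].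
  rewrite inE => /schur_tripleP[x [y [z [e xy _]]]].
  by move: xy (ltn_ord z); rewrite -val_eqE /=; lia.
have := schur_count_initial (leqnn N).
have -> : [set i : 'I_N | (i < N)%N] = setT.
  by apply/setP => i; rewrite !inE ltn_ord.
(* N = 5 is the worst case of the rounding for N >= 3. *)
have : (N <= 5 * (N %/ 3))%N by lia.
move: (N %/ 3)%N (schur_count _) => h T; rewrite -!mulnn; nia.
Qed.

(** * The two tail bounds *)

Section Bounds.
Variables (R : realType) (N : nat) (p t : R).
Hypotheses (p0 : 0 < p) (p1 : p < 1) (t1 : 1 < t) (mu1 : 1 <= schur_mean N p).
Let p01 : 0 <= p <= 1. Proof. by rewrite !ltW. Qed.
Let q := N%:R * p `^ (3 / 2).

Lemma powR32_sqr : (p `^ (3 / 2)) ^+ 2 = p ^+ 3.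
Proof.
by rewrite -powR_mulrn ?powR_ge0// -powRrM divfK ?pnatr_eq0// powR_mulrn// ltW.
Qed.

Lemma scale_ge0 : 0 <= q. Proof. by rewrite mulr_ge0// powR_ge0. Qed.

Lemma scale_sqr : q ^+ 2 = N%:R ^+ 2 * p ^+ 3.
Proof. by rewrite exprMn powR32_sqr. Qed.

Lemma schur_mean_le : schur_mean N p <= 2 * q ^+ 2.
Proof.
have : (schur_count [set: 'I_N])%:R <= (2 * N ^ 2)%:R :> R.
  by rewrite ler_nat schur_count_le.
rewrite schur_meanE scale_sqr natrM natrX => h.
have p3 : 0 <= p ^+ 3 by rewrite exprn_ge0// ltW.
nra.
Qed.

Lemma schur_mean_ge : q ^+ 2 <= 25 * schur_mean N p.
Proof.
have T0 : (0 < schur_count [set: 'I_N])%N.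
  by move: mu1; rewrite schur_meanE; case: (schur_count _) => //; rewrite mulr0 ler10.
have : (N ^ 2)%:R <= (25 * schur_count [set: 'I_N])%:R :> R.
  by rewrite ler_nat schur_count_ge.
rewrite schur_meanE scale_sqr natrM natrX => h.
have p3 : 0 <= p ^+ 3 by rewrite exprn_ge0// ltW.
nra.
Qed.

(** This absorbs the rounding up of the length of the planted segment. *)
Lemma scale_ge : 1 <= 2 * q.
Proof.
have := mu1; have := schur_mean_le; have := scale_ge0.
move: q (schur_mean N p) => x mu x0 mu_le mu_ge; nra.
Qed.

Lemma expR_scale (C : R) :
  p `^ (C * N%:R * p `^ (3 / 2))
    = expR (- (C * N%:R * p `^ (3 / 2) * ln (1 / p))).
Proof.
by rewrite {1}/powR gt_eqF// div1r lnV ?posrE// mulrN opprK.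
Qed.

(** The planted segment has length m = 3 h with h just above 2 t q, for then it
    contains h^2 >= 4 t^2 q^2 >= 2 t q^2 >= t mu triples, while
    m <= 6 t q + 3 <= (6 t + 6) q. *)
Lemma schur_tail_ge : t <= p ^- 3 ->
  p `^ ((6 * t + 6) * q)
    <= rset_prob p (fun A : {set 'I_N} =>
         t * schur_mean N p <= (schur_count A)%:R).
Proof.
move=> tp3.
pose h := (Num.truncn (2 * t * q)).+1.
pose m := minn N (3 * h).
pose I := [set i : 'I_N | (i < m)%N].
have q0 := scale_ge0; have q1 := scale_ge.
have t0 : 0 < t by rewrite (lt_trans ltr01).
have tq0 : 0 <= 2 * t * q by rewrite mulr_ge0// mulr_ge0// ltW.
have /andP[hle hgt] := truncn_itv tq0; rewrite -/h in hgt.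
have Imu : t * schur_mean N p <= (schur_count I)%:R.
  have [Nh|hN] := leqP N (3 * h).
    have -> : I = setT by apply/setP => i; rewrite !inE /m (minn_idPl Nh) ltn_ord.
    have tp : t * p ^+ 3 <= 1 by rewrite -ler_pdivlMr ?exprn_gt0// div1r.
    by rewrite schur_meanE mulrA ler_piMl.
  have mE : m = (3 * h)%N by rewrite /m (minn_idPr (ltnW hN)).
  have : (((m %/ 3) ^ 2)%N)%:R <= (schur_count I)%:R :> R.
    by rewrite ler_nat schur_count_initial// geq_minl.
  rewrite mE mulKn// natrX; apply: le_trans.
  have := schur_mean_le.
  have : (2 * t * q) ^+ 2 <= h%:R ^+ 2 :> R.
    by rewrite lerXn2r ?nnegrE// ltW.
  move=> h1 h2; apply: le_trans h1.
  have -> : (2 * t * q) ^+ 2 = 4 * (t ^+ 2 * q ^+ 2) by ring.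
  have : t * schur_mean N p <= t * (2 * q ^+ 2).
    by rewrite ler_wpM2l// ltW.
  have : t * q ^+ 2 <= t ^+ 2 * q ^+ 2.
    by rewrite ler_wpM2r ?exprn_ge0// expr2 ler_peMl// ltW.
  have : 0 <= t * q ^+ 2 by rewrite mulr_ge0 ?exprn_ge0// ltW.
  lra.
apply: (@le_trans _ _ (rset_prob p (fun A : {set 'I_N} => I \subset A))); last first.
  apply: rset_prob_le => // A IA; apply: le_trans Imu _.
  by rewrite ler_nat !schur_countE edge_count_monotone.
rewrite rset_prob_subset -powR_mulrn ?(ltW p0)//.
have Im : (#|I| <= m)%N.
  rewrite cardE -(size_map val) -[leqRHS](size_iota 0).
  apply: uniq_leq_size => [|_ /mapP[i iI ->]].
    by rewrite (map_inj_uniq val_inj) enum_uniq.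
  by move: iI; rewrite mem_enum mem_iota inE.
rewrite ger_powR// ?p0 ?(ltW p1)//.
apply: (@le_trans _ _ (3 * h)%:R).
  by rewrite ler_nat (leq_trans Im)// geq_minr.
rewrite natrM /h -natr1; lra.
Qed.

(** The excess over mu is at most 6 a q^2 + 18 a q^2, and q^2 <= 25 mu; the
    first term uses N p^2 <= q. *)
Lemma schur_residual_le (V : {set 'I_N}) (a : R) :
  0 <= a <= 1 -> #|V|%:R <= 3 * a * q ->
  \sum_(B in schur_triples N) p ^+ #|B :\: V|
    <= (1 + 600 * a) * schur_mean N p.
Proof.
move=> /andP[a0 a1] Va.
have := sum_residual_le V p01 (@codegree_schur N) (@card_schur_triple N).
rewrite -schur_countT -schur_meanE => /le_trans; apply.
have q0 := scale_ge0; have := schur_mean_ge.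
have V0 : 0 <= #|V|%:R :> R by [].
rewrite !natrM.
have h2 : #|V|%:R * #|V|%:R <= 9 * a * q ^+ 2.
  have : #|V|%:R * #|V|%:R <= (3 * a * q) * (3 * a * q) by rewrite ler_pM.
  have : 0 <= q ^+ 2 by rewrite exprn_ge0.
  have : a * a <= a by rewrite ler_piMr.
  nra.
have h3 : N%:R * p ^+ 2 <= q.
  rewrite /q ler_wpM2l// -(@ler_pXn2r _ 2) ?nnegrE ?exprn_ge0 ?powR_ge0 ?(ltW p0)//.
  by rewrite powR32_sqr -exprM ler_wiXn2l// ltW.
have h1 : #|V|%:R * N%:R * p ^+ 2 <= 3 * a * q ^+ 2.
  have : #|V|%:R * (N%:R * p ^+ 2) <= (3 * a * q) * q.
    by rewrite ler_pM// mulr_ge0// exprn_ge0// ltW.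
  nra.
nra.
Qed.

(** Markov's inequality for the moment of order k + 1, k being the integer part
    of a q: at most k triples precede the last one, so the sets V involved have
    at most 3 a q elements, while the exponent k + 1 exceeds a q. *)
Lemma schur_tail_le (a : R) : 0 <= a <= 1 -> (1 + 600 * a) / t < 1 ->
  rset_prob p (fun A : {set 'I_N} =>
     t * schur_mean N p <= (schur_count A)%:R)
    <= expR (- (a * ln (t / (1 + 600 * a)) * q)).
Proof.
move=> a01 st1; have /andP[a0 _] := a01.
set s := 1 + 600 * a in st1 *.
have t0 : 0 < t by rewrite (lt_trans ltr01).
have s0 : 0 < s by rewrite ltr_pwDl// mulr_ge0.
have mu0 : 0 < schur_mean N p by rewrite (lt_le_trans ltr01).
have aq0 : 0 <= a * q by rewrite mulr_ge0// scale_ge0.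
have /andP[kle kgt] := truncn_itv aq0.
set k := Num.truncn (a * q) in kle kgt.
apply: le_trans (@rset_markov _ _ p (t * schur_mean N p) k.+1
  (fun A : {set 'I_N} => (schur_count A)%:R) p01 (mulr_gt0 t0 mu0) _) _ => //.
have mom : rset_mean p (fun A : {set 'I_N} => (schur_count A)%:R ^+ k.+1)
    <= (s * schur_mean N p) ^+ k.+1.
  have := @edge_count_moment R N 3 (schur_triples N) p (s * schur_mean N p) k.+1 set0 p01.
  rewrite cards0 expr0 mul1r /rset_mean => /(_ _ _) mom.
  under eq_bigr do rewrite schur_countE.
  rewrite (eq_bigl (fun A : {set 'I_N} => set0 \subset A)); last first.
    by move=> A; rewrite sub0set.
  apply: mom => [B /card_schur_triple -> //|V Vk].
  apply: schur_residual_le => //.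
  have : #|V|%:R <= (3 * k)%:R :> R by rewrite ler_nat -(leq_add2l 3) -mulnS addnC.
  by move=> /le_trans; apply; rewrite natrM -mulrA ler_wpM2l.
apply: (@le_trans _ _ ((s / t) ^+ k.+1)).
  rewrite ler_pdivrMr ?exprn_gt0 ?mulr_gt0// -exprMn.
  by rewrite [_ / _ * _](_ : _ = s * schur_mean N p) //; field; rewrite gt_eqF.
have st0 : 0 < s / t by rewrite divr_gt0.
rewrite -[s / t]lnK ?posrE// -expRM_natl ler_expR.
have -> : ln (t / s) = - ln (s / t) by rewrite -lnV ?posrE// invf_div.
have L0 : ln (s / t) < 0 by rewrite ln_lt0// st0.
have : k.+1%:R * ln (s / t) <= (a * q) * ln (s / t).
  by rewrite ler_wnM2r// ltW.
by rewrite mulrN mulNr opprK mulrAC.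
Qed.
End Bounds.

Theorem corollary2p6 (R : realType) (t : R) (ht : 1 < t) :
  exists c C : R, [/\ 0 < c, 0 < C &
    forall (N : nat) (p : R),
      (1 <= N)%N -> 0 < p -> p < 1 ->
      1 <= schur_mean N p -> t <= p ^- 3 ->
      [/\ p `^ (C * N%:R * p `^ (3 / 2))
            = expR (- (C * N%:R * p `^ (3 / 2) * ln (1 / p))),
          expR (- (C * N%:R * p `^ (3 / 2) * ln (1 / p)))
            <= rset_prob p (fun A : {set 'I_N} =>
                 t * schur_mean N p <= (schur_count A)%:R) &
          rset_prob p (fun A : {set 'I_N} =>
            t * schur_mean N p <= (schur_count A)%:R)
            <= expR (- (c * N%:R * p `^ (3 / 2)))]].
Proof.
have t0 : 0 < t by rewrite (lt_trans ltr01).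
(* This choice gives 600 a = (t - 1) / (2 t) < t - 1. *)
pose a : R := (t - 1) / (1200 * t).
have a0 : 0 < a by rewrite divr_gt0 ?mulr_gt0// subr_gt0.
have aE : 1200 * t * a = t - 1 by rewrite /a; field; rewrite gt_eqF.
have a1 : a <= 1 by nra.
have sgt0 : 0 < 1 + 600 * a by lra.
have st1 : (1 + 600 * a) / t < 1 by rewrite ltr_pdivrMr// mul1r; nra.
exists (a * ln (t / (1 + 600 * a))), (6 * t + 6); split=> [||N p _ p0 p1 mu1 tp3].
- by rewrite mulr_gt0// ln_gt0// ltr_pdivlMr// mul1r -[t]mul1r -ltr_pdivrMr.
- by lra.
- split.
  + exact: expR_scale.
  + by rewrite -expR_scale// -mulrA schur_tail_ge.
  + by rewrite -mulrA schur_tail_le// ltW.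
Qed.
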